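(* Let $p$ be an odd prime. For $0<k<p$ let $g_k(\alpha)\in\mathbb F_p(\alpha)$ be as defined in the context, and for an integer $d$ and a parameter $\gamma$ put $\pounds_d^{(\gamma)}(X)=\sum_{k=1}^{p-1}g_k(\gamma)X^k/k^d$. Let $T(X)=\prod_{i=1}^{p-1}(1+X/i)^i$. Then for $0<h<p$ and $0<d<p-1$, \[ \pounds_d^{(h\alpha)}\bigl(g_h(\alpha)X^h\bigr)\equiv h^d\,\pounds_d^{(\alpha)}(X)\pmod{X^p-T(\alpha)} \] in $\mathbb F_p(\alpha)[X]$.
   Context: For integers $0<k<p$ and $0<a<p$, $e(k,a)$ is the exponent of the highest power of $p$ dividing $\prod_{s=1}^{k}\binom{sa}{a}$, and $g_k(\alpha)=\prod_{0<a<p}(1+\alpha/a)^{-e(k,a)}$ viewed in $\mathbb F_p(\alpha)$; $g_k(h\alpha)$ is obtained by substituting $h\alpha$ for $\alpha$. *)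

(* Defs.v *)
From HB Require Import structures.
From mathcomp Require Import all_boot all_order all_algebra.

Set Implicit Arguments.
Unset Strict Implicit.
Unset Printing Implicit Defensive.

Import Order.TTheory GRing.Theory Num.Theory.
Local Open Scope ring_scope.

Definition e (p k a : nat) : nat :=
  logn p (\prod_(1 <= s < k.+1) 'C(s * a, a))%N.

(* The rational function g_k is kept as a function of its parameter, so that
   g p k (h%:R * alpha) is the result of substituting h alpha for alpha. *)
Definition g (K : fieldType) (p k : nat) (gamma : K) : K :=
  \prod_(1 <= a < p) (1 + gamma / a%:R) ^- e p k a.

Definition pounds (K : fieldType) (p : nat) (d : int) (gamma : K) : {poly K} :=
  \sum_(1 <= k < p) (g p k gamma / k%:R ^ d) *: 'X^k.

Definition T (K : fieldType) (p : nat) : {poly K} :=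
  \prod_(1 <= i < p) (1 + i%:R^-1 *: 'X) ^+ i.

(* This is F_p(alpha) only when p is prime, as 'F_p is otherwise the prime field
   of the least prime divisor of p. *)
Definition Fpalpha (p : nat) : fieldType := {fraction {poly 'F_p}}.

Definition alpha (p : nat) : Fpalpha p := tofrac ('X : {poly 'F_p}).

Definition congr_polymod (K : fieldType) (A B M : {poly K}) : Prop :=
  M %| A - B.

(* Main.v *)
Require Import Defs.
From HB Require Import structures.
From mathcomp Require Import all_boot all_order all_algebra.

Set Implicit Arguments.
Unset Strict Implicit.
Unset Printing Implicit Defensive.

Import Order.TTheory GRing.Theory Num.Theory.
Local Open Scope ring_scope.

(** The product of the binomials ['C(s a, a)], [s <= k], telescopes to
    [(k a)! / a!^k], so [e(k, a) = floor (k a / p)].  Writing [hk = q p + r] with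
    [0 < r < p], reduction modulo [X^p - T(alpha)] replaces [X^(hk)] by
    [T(alpha)^q X^r], and the congruence holds term by term because of the
    identity [g_k(h alpha) g_h(alpha)^k T(alpha)^q = g_r(alpha)].  The latter is
    checked by comparing the exponents of [1 + alpha / b]: after substituting
    [a = hb mod p] in [g_k(h alpha)], both sides reduce to
    [b floor (hk / p) - floor (hkb / p)]. *)

Lemma prod_bin_mul_fact (k a : nat) :
  ((\prod_(1 <= s < k.+1) 'C(s * a, a)) * a`! ^ k = (k * a)`!)%N.
Proof.
elim: k => [|k IHk]; first by rewrite big_geq.
rewrite big_nat_recr //= expnS mulSn -(bin_fact (leq_addr (k * a) a)).
by rewrite addKn -IHk [X in (X * _ = _)%N]mulnC mulnACA -mulnA.
Qed.

(** In Legendre's formula every term beyond the first is a quotient of [n] by at least [p ^ 2],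
    hence zero. *)
Lemma logn_fact_lt_sqr (p n : nat) :
  prime p -> (n < p ^ 2)%N -> logn p n`! = (n %/ p)%N.
Proof.
move=> p_pr n_lt; rewrite logn_fact //.
have [->|n_gt0] := posnP n; first by rewrite big_geq // div0n.
rewrite big_ltn // expn1 big_nat big1 ?addn0 // => i /andP[i_gt1 _].
by rewrite divn_small // (leq_trans n_lt) // leq_pexp2l ?prime_gt0.
Qed.

Lemma e_divn (p k a : nat) :
  prime p -> (k < p)%N -> (a < p)%N -> e p k a = (k * a %/ p)%N.
Proof.
move=> p_pr k_lt a_lt.
have ka_lt : (k * a < p ^ 2)%N by rewrite -mulnn ltn_mul.
have a_lt2 : (a < p ^ 2)%N.
  by rewrite (ltn_trans a_lt) // ltn_Pmulr ?prime_gt1 ?prime_gt0.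
rewrite -(logn_fact_lt_sqr p_pr ka_lt) -prod_bin_mul_fact.
rewrite lognM ?expn_gt0 ?fact_gt0 //.
  by rewrite lognX logn_fact_lt_sqr // divn_small // muln0 addn0.
rewrite big_nat prodn_cond_gt0 // => s /andP[s_gt0 _].
by rewrite bin_gt0 leq_pmull.
Qed.

(** Multiplication by [h] permutes the nonzero residues. This reindexes both the product inside [g]
    and the sum inside [pounds]. *)
Lemma big_mulmodn (R : Type) (idx : R) (op : Monoid.com_law idx) (p h : nat)
    (F : nat -> R) : prime p -> (0 < h < p)%N ->
  \big[op/idx]_(1 <= k < p) F k = \big[op/idx]_(1 <= k < p) F (h * k %% p)%N.
Proof.
move=> p_pr /andP[h_gt0 h_lt].
have co_ph : coprime p h by rewrite prime_coprime // gtnNdvd.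
rewrite -(big_map (fun k => h * k %% p)%N predT F); apply: perm_big.
rewrite perm_sym; set s := index_iota 1 p; set t := map _ _.
have t_uniq : uniq t.
  rewrite map_inj_in_uniq ?iota_uniq // => i j.
  rewrite !mem_index_iota => /andP[_ i_lt] /andP[_ j_lt].
  (* Ordering [i] and [j] lets the congruence be read as divisibility of a truncated difference. *)
  wlog le_ij : i j i_lt j_lt / (i <= j)%N => [wlog_le eq_ij|].
    by case/orP: (leq_total i j) => ?; [|apply/esym]; apply: wlog_le.
  move/esym/eqP; rewrite eqn_mod_dvd ?leq_mul // -mulnBr Gauss_dvdr //.
  by rewrite -eqn_mod_dvd // !modn_small // => /eqP.
have t_sub : {subset t <= s}.
  move=> r /mapP[k]; rewrite mem_index_iota => /andP[k_gt0 k_lt] ->.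
  rewrite mem_index_iota ltn_mod (prime_gt0 p_pr) andbT lt0n -/(dvdn p _).
  by rewrite Gauss_dvdr // gtnNdvd.
have [_ t_eq] := uniq_min_size t_uniq t_sub (eq_leq (esym (size_map _ _))).
by apply: uniq_perm; rewrite ?iota_uniq.
Qed.

Section PositiveCharacteristic.

Variables (K : fieldType) (p : nat).
Hypothesis p_char : p \in [pchar K].

Let p_pr : prime p := pcharf_prime p_char.

Lemma natr_modn (n : nat) : (n %% p)%:R = n%:R :> K.
Proof. by rewrite {2}(divn_eq n p) natrD natrM (pcharf0 p_char) mulr0 add0r. Qed.

Lemma natr_neq0 (n : nat) : (0 < n < p)%N -> n%:R != 0 :> K.
Proof. by case/andP=> n_gt0 n_lt; rewrite -(dvdn_pcharf p_char) gtnNdvd. Qed.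

Lemma g_divn (k : nat) (gamma : K) : (k < p)%N ->
  g p k gamma = \prod_(1 <= a < p) (1 + gamma / a%:R) ^- (k * a %/ p).
Proof.
by move=> k_lt; apply: eq_big_nat => a /andP[_ a_lt]; rewrite e_divn.
Qed.

(** With [a = h * b %% p], which equals [h * b] in [K], the quotient of [h * gamma] by [a] is that
    of [gamma] by [b]. *)
Lemma g_scale (k h : nat) (gamma : K) : (0 < h < p)%N -> (k < p)%N ->
  g p k (h%:R * gamma) =
  \prod_(1 <= b < p) (1 + gamma / b%:R) ^- (k * (h * b %% p) %/ p).
Proof.
move=> h_bnd k_lt; rewrite g_divn // (big_mulmodn _ _ p_pr h_bnd).
apply: eq_big_nat => b b_bnd; rewrite natr_modn natrM invfM mulrACA.
by rewrite divff ?mul1r // natr_neq0.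
Qed.

Lemma hornerT (gamma : K) :
  (T K p).[gamma] = \prod_(1 <= i < p) (1 + gamma / i%:R) ^+ i.
Proof.
rewrite /T horner_prod; apply: eq_bigr => i _.
by rewrite !hornerE mulrC.
Qed.

Lemma g_mul (h k : nat) (gamma : K) :
    (forall a, (0 < a < p)%N -> 1 + gamma / a%:R != 0) ->
    (0 < h < p)%N -> (k < p)%N ->
  g p k (h%:R * gamma) * g p h gamma ^+ k * (T K p).[gamma] ^+ (h * k %/ p) =
  g p (h * k %% p) gamma.
Proof.
move=> nz h_bnd k_lt; have p_gt0 := prime_gt0 p_pr.
rewrite g_scale // !g_divn ?ltn_mod //; last by case/andP: h_bnd.
rewrite hornerT -!prodrXl -!big_split /=; apply: eq_big_nat => b b_bnd.
have := nz b b_bnd; move: (1 + _) => L L_neq0.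
(* Both identities absorb an integer into a floor as a multiple of [p], then recombine quotient and
   remainder: of [h * b] here, of [h * k] in [exp2]. *)
have exp1 : (k * (h * b %% p) %/ p + (h * b %/ p) * k = h * k * b %/ p)%N.
  rewrite addnC -(divnMDl _ _ p_gt0); congr (_ %/ _)%N.
  rewrite mulnAC [X in (X + _)%N]mulnC -mulnDr -divn_eq.
  by rewrite mulnA [(k * h)%N]mulnC.
have exp2 : (b * (h * k %/ p) + (h * k %% p) * b %/ p = h * k * b %/ p)%N.
  rewrite -(divnMDl _ _ p_gt0); congr (_ %/ _)%N.
  by rewrite -mulnA mulnC -mulnDl -divn_eq.
rewrite exprVn -!exprM -invfM -exprD exp1 -exp2 exprD invfM.
by rewrite mulrAC mulVf ?mul1r // expf_neq0.
Qed.

Lemma pounds_comp (h : nat) (d : int) (gamma : K) :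
    (forall a, (0 < a < p)%N -> 1 + gamma / a%:R != 0) -> (0 < h < p)%N ->
  'X^p - (T K p).[gamma]%:P %|
    (pounds p d (h%:R * gamma) \Po (g p h gamma *: 'X^h))
      - (h%:R ^ d) *: pounds p d gamma.
Proof.
move=> nz h_bnd.
rewrite /pounds scaler_sumr linear_sum /=.
(* The term in [X^(hk)] on the left is paired with the term of index [h * k %% p] on the right. *)
rewrite [X in _ %| _ - X](big_mulmodn _ _ p_pr h_bnd) -sumrB big_nat.
elim/big_ind: _ => [|A B|k k_bnd]; [exact: dvdp0 | exact: dvdp_add |].
have [k_gt0 k_lt] := andP k_bnd.
rewrite comp_polyZ comp_Xn_poly exprZn -exprM !scalerA.
rewrite -(g_mul nz h_bnd k_lt) natr_modn natrM expfzMl.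
have hd_neq0 : h%:R ^ d != 0 :> K by rewrite expfz_neq0 ?natr_neq0.
set c := g p k _; set u := _ ^+ k; set t := _.[_].
have -> : (h%:R ^ d) * (c * u * t ^+ (h * k %/ p) / (h%:R ^ d * k%:R ^ d)) =
    c / k%:R ^ d * u * t ^+ (h * k %/ p).
  by rewrite invfM mulrCA mulVKf // mulrAC [X in X * _]mulrAC.
rewrite -[X in _ %| _ - X]scalerA -scalerBr -mul_polyC dvdp_mull //.
(* With [q] and [r] the quotient and remainder of [h * k] by [p], what is left is
   [((X^p)^q - t^q) X^r], and [X^p - t] divides a difference of [q]-th powers. *)
rewrite {1}(divn_eq (h * k) p) exprD mulnC exprM -mul_polyC rmorphXn /= -mulrBl.
by rewrite subrXX -mulrA dvdp_mulIl.
Qed.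

End PositiveCharacteristic.

Lemma pchar_Fpalpha (p : nat) : prime p -> p \in [pchar Fpalpha p].
Proof.
move=> p_pr; rewrite inE p_pr /=.
by rewrite -(rmorph_nat (@tofrac {poly 'F_p})) -polyC_natr pchar_Fp_0 //
  polyC0 rmorph0.
Qed.

(** The numerator over [a] is the image of the degree-one polynomial [X + a], and the embedding into
    fractions is injective. *)
Lemma alpha_linear_neq0 (p a : nat) :
  (0 < a < p)%N -> prime p -> 1 + alpha p / a%:R != 0.
Proof.
move=> a_bnd p_pr; have a_neq0 := natr_neq0 (pchar_Fpalpha p_pr) a_bnd.
rewrite -[X in X + _](divff a_neq0) -mulrDl mulf_neq0 ?invr_eq0 //.
rewrite -(rmorph_nat (@tofrac {poly 'F_p})) /alpha -rmorphD /= tofrac_eq0.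
by rewrite addrC -polyC_natr -size_poly_eq0 size_XaddC.
Qed.

Theorem theorem6 (p : nat) (p_prime : prime p) (p_odd : odd p)
    (h : nat) (h_gt0 : (0 < h)%N) (h_lt : (h < p)%N)
    (d : int) (d_gt0 : 0 < d) (d_lt : d < p%:Z - 1) :
  congr_polymod
    (pounds p d (h%:R * alpha p) \Po (g p h (alpha p) *: 'X^h))
    ((h%:R ^ d) *: pounds p d (alpha p))
    ('X^p - (T (Fpalpha p) p).[alpha p]%:P).
Proof.
apply: pounds_comp; [exact: pchar_Fpalpha | | by rewrite h_gt0].
by move=> a a_bnd; exact: alpha_linear_neq0.
Qed.
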